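(* Consider the state-space model, the backward-factorized variational distributions $q_t^\phi(x_{1:t})$, the ratio $m_{t+1}^\phi$ and the evidence lower bound $\mathcal{L}_t(\theta,\phi)$ defined in the context. The evidence lower bound satisfies, for $t\ge 1$, $$\mathcal{L}_t(\theta,\phi)=\mathbb{E}_{q_t^\phi(x_t)}\left[V_t^{\theta,\phi}(x_t)\right]\quad\text{for}\quad V_t^{\theta,\phi}(x_t):=\mathbb{E}_{q_t^\phi(x_{1:t-1}|x_t)}\left[\log\frac{p_\theta(x_{1:t},y^t)}{q_t^\phi(x_{1:t})}\right],$$ with the convention $V_1^{\theta,\phi}(x_1):=r_1^{\theta,\phi}(x_0,x_1):=\log\big(p_\theta(x_1,y_1)/q_1^\phi(x_1)\big)$. Additionally, $$V_{t+1}^{\theta,\phi}(x_{t+1})=\mathbb{E}_{q_{t+1}^\phi(x_t|x_{t+1})}\left[V_t^{\theta,\phi}(x_t)+r_{t+1}^{\theta,\phi}(x_t,x_{t+1})\right],$$ where $$r_{t+1}^{\theta,\phi}(x_t,x_{t+1}):=\log\frac{f_\theta(x_{t+1}|x_t)\,g_\theta(y_{t+1}|x_{t+1})}{m_{t+1}^\phi(x_{t+1}|x_t)}.$$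
   Context: State-space model: latent states $x_t\in\mathbb{R}^{d_x}$ form a Markov process, observations $y_t\in\mathcal{Y}$ are conditionally independent given the latent process, and $\theta\in\mathbb{R}^{d_\theta}$ is a parameter; $\mu_\theta(x_1)$ is the initial density, $f_\theta(x_{t+1}|x_t)$ the transition density and $g_\theta(y_t|x_t)$ the observation density. Write $y^t=(y_1,\dots,y_t)$ and $$p_\theta(x_{1:t},y^t)=\mu_\theta(x_1)g_\theta(y_1|x_1)\prod_{k=2}^t f_\theta(x_k|x_{k-1})g_\theta(y_k|x_k).$$ Variational family: for a variational parameter $\phi$, $q_t^\phi(x_t)$ is a probability density on $\mathbb{R}^{d_x}$ (a variational approximation of the filtering distribution $p_\theta(x_t|y^t)$) and $q_{k+1}^\phi(x_k|x_{k+1})$ is a conditional probability density (a variational approximation of the backward kernel $p_\theta(x_k|y^k,x_{k+1})$); dependence on the observations is suppressed from the notation. In general $\int q_{t+1}^\phi(x_t|x_{t+1})q_{t+1}^\phi(x_{t+1})\,\mathrm{d}x_{t+1}\neq q_t^\phi(x_t)$. Define $$q_t^\phi(x_{1:t})=q_t^\phi(x_t)\prod_{k=1}^{t-1}q_{k+1}^\phi(x_k|x_{k+1}),$$ so that the conditional density of $x_{1:t-1}$ given $x_t$ under it is $q_t^\phi(x_{1:t-1}|x_t)=\prod_{k=1}^{t-1}q_{k+1}^\phi(x_k|x_{k+1})$, and $$m_{t+1}^\phi(x_{t+1}|x_t):=\frac{q_{t+1}^\phi(x_t|x_{t+1})\,q_{t+1}^\phi(x_{t+1})}{q_t^\phi(x_t)},$$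 which typically does not integrate to one in $x_{t+1}$. One has $q_{t+1}^\phi(x_{1:t+1})=q_t^\phi(x_{1:t})\,m_{t+1}^\phi(x_{t+1}|x_t)$. The evidence lower bound (ELBO) is $$\mathcal{L}_t(\theta,\phi):=\mathbb{E}_{q_t^\phi(x_{1:t})}\left[\log\frac{p_\theta(x_{1:t},y^t)}{q_t^\phi(x_{1:t})}\right].$$ *)

(* Defs.v *)
From HB Require Import structures.
From mathcomp Require Import all_boot all_order all_algebra.
From mathcomp Require Import all_classical all_reals all_analysis.

Set Implicit Arguments.
Unset Strict Implicit.
Unset Printing Implicit Defensive.
Import Order.TTheory GRing.Theory Num.Theory.
Import numFieldNormedType.Exports.

Local Open Scope classical_set_scope.
Local Open Scope ring_scope.

Section tuple_measure.
Context d (T : measurableType d) (R : realType).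

Definition rcons_pair n (wx : n.-tuple T * T) : n.+1.-tuple T :=
  [tuple of rcons wx.1 wx.2].

Lemma measurable_rcons_pair n : measurable_fun setT (@rcons_pair n).
Proof.
apply/measurable_fun_tnthP => i.
have [ilt|ige] := ltnP i n.
- rewrite (_ : _ \o _ = (fun w : n.-tuple T => tnth w (Ordinal ilt)) \o fst).
    by apply: measurableT_comp => //; exact: measurable_tnth.
  apply/funext => -[w x] /=.
  by rewrite !(tnth_nth x) /= nth_rcons size_tuple ilt.
- rewrite (_ : _ \o _ = snd)//.
  apply/funext => -[w x] /=.
  have ni : i = n :> nat by apply/eqP; rewrite eqn_leq ige -ltnS ltn_ord.
  by rewrite (tnth_nth x) /= nth_rcons size_tuple ni ltnn eqxx.
Qed.

Section step.
Variables (mu : {sigma_finite_measure set T -> \bar R}) (n : nat).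
Variable P : {sigma_finite_measure set (n.-tuple T) -> \bar R}.

Definition tuple_measure_step : set (n.+1.-tuple T) -> \bar R :=
  pushforward (P \x mu)%E (@rcons_pair n).

HB.instance Definition _ := Measure.copy tuple_measure_step
  (measure_function_pushforward__canonical__measure_function_Measure
     (P \x mu)%E (@measurable_rcons_pair n)).

Let tuple_measure_step_sigma_finite : sigma_finite setT tuple_measure_step.
Proof.
have /sigma_finiteP[F [TF ndF Foo]] := sigma_finiteT P.
have /sigma_finiteP[G [TG ndG Goo]] := sigma_finiteT mu.
pose unrcons (z : n.+1.-tuple T) : n.-tuple T * T :=
  ([tuple tnth z (widen_ord (leqnSn n) i) | i < n], tnth z ord_max).
have munrcons : measurable_fun setT unrcons.
  apply/measurable_fun_pairP; split.
    apply/measurable_fun_tnthP => i.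
    rewrite (_ : _ \o _ = fun z => tnth z (widen_ord (leqnSn n) i)).
      exact: measurable_tnth.
    by apply/funext => z /=; rewrite tnth_mktuple.
  exact: measurable_tnth.
have rconsK : cancel (@rcons_pair n) unrcons.
  move=> [w x]; rewrite /unrcons; congr pair.
    apply: eq_from_tnth => i; rewrite tnth_mktuple !(tnth_nth x) /=.
    by rewrite nth_rcons size_tuple ltn_ord.
  by rewrite (tnth_nth x) /= nth_rcons size_tuple ltnn eqxx.
exists (fun i => unrcons @^-1` (F i `*` G i)).
  rewrite -preimage_bigcup -[LHS](preimage_setT unrcons); congr (_ @^-1` _).
  rewrite -setXTT TF TG; apply/seteqP; split=> -[w x] /=.
    move=> [[i _ Fiw] [j _ Gjx]]; exists (maxn i j) => //; split.
      by move: w Fiw; exact/subsetPset/ndF/leq_maxl.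
    by move: x Gjx; exact/subsetPset/ndG/leq_maxr.
  by move=> [i _ [Fiw Gix]]; split; exists i.
move=> i; have [mFi Fioo] := Foo i; have [mGi Gioo] := Goo i; split.
  by rewrite -[X in measurable X]setTI; apply: munrcons => //; exact: measurableX.
rewrite /tuple_measure_step /pushforward -comp_preimage.
rewrite (_ : unrcons \o _ = id); last by apply/funext => wx; exact: rconsK.
by rewrite preimage_id product_measure1E// lte_mul_pinfty// ge0_fin_numE.
Qed.

HB.instance Definition _ := Measure_isSigmaFinite.Build _ _ _
  tuple_measure_step tuple_measure_step_sigma_finite.

End step.

(* tuple_measure mu n is the n-fold product of mu, on the product            *)
(* sigma-algebra of n.-tuple T.                                              *)
Fixpoint tuple_measure (mu : {sigma_finite_measure set T -> \bar R}) (n : nat) :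
    {sigma_finite_measure set (n.-tuple T) -> \bar R} :=
  match n with
  | 0 => \d_([tuple] : 0.-tuple T)
  | n'.+1 => tuple_measure_step mu (tuple_measure mu n')
  end.

End tuple_measure.

Notation euclidean R n := (n.-tuple (measurableTypeR R)).

Definition lebesgue (R : realType) (n : nat) :
    {sigma_finite_measure set (euclidean R n) -> \bar R} :=
  tuple_measure (lebesgue_measure : {sigma_finite_measure set _ -> \bar R}) n.

Section densities.
Context d (T : measurableType d) (R : realType).

Definition is_density (mu : {measure set T -> \bar R}) (p : T -> R) :=
  [/\ measurable_fun setT p, forall x, 0 <= p x & (\int[mu]_x (p x)%:E = 1)%E].

(* k x u stands for k(x | u). *)
Definition is_cond_density d' (U : measurableType d')
    (mu : {measure set T -> \bar R}) (k : T -> U -> R) :=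
  measurable_fun setT (fun xu : T * U => k xu.1 xu.2) /\
  forall u, is_density mu (k^~ u).

(* With 0 * (+oo) = 0 * (-oo) = 0, values of h off the support of p are      *)
(* irrelevant.                                                               *)
Definition expect (mu : {measure set T -> \bar R}) (p : T -> R)
    (h : T -> \bar R) : \bar R :=
  (\int[mu]_x ((p x)%:E * h x))%E.

(* The integral is well defined in [-oo, +oo], i.e., is not oo - oo.         *)
Definition expect_exists (mu : {measure set T -> \bar R}) (p : T -> R)
    (h : T -> \bar R) : Prop :=
  (\int[mu]_x ((fun x => (p x)%:E * h x)^\+ x) < +oo \/
   \int[mu]_x ((fun x => (p x)%:E * h x)^\- x) < +oo)%E.

End densities.

(* Times are 1-based: x_k, y_k, q_k, ... are indexed by k >= 1. Trajectories *)
(* x_{1:t} with t >= 1 are tuples of length n.+1, where t = n.+1.            *)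

(* x_k for 1 <= k <= n.+1 *)
Definition at_time (T : Type) n (x : n.+1.-tuple T) (k : nat) : T :=
  nth (thead x) x k.-1.

(* trans th x' x = f_th(x' | x) and obs th y x = g_th(y | x)                 *)
Record ssm (R : realType) d (X : measurableType d)
    (lam : {sigma_finite_measure set X -> \bar R})
    dY (Y : measurableType dY) (nu : {measure set Y -> \bar R})
    (Theta : Type) := SSM {
  init : Theta -> X -> R;
  trans : Theta -> X -> X -> R;
  obs : Theta -> Y -> X -> R;
  init_density : forall th, is_density lam (init th);
  trans_density : forall th, is_cond_density lam (trans th);
  obs_density : forall th, is_cond_density nu (obs th) }.

(* filt phi t x = q_t^phi(x), and back phi t.+1 x x' = q_{t+1}^phi(x | x')   *)
(* is the density of x_t = x given x_{t+1} = x'.                             *)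
Record variational_family (R : realType) d (X : measurableType d)
    (lam : {sigma_finite_measure set X -> \bar R}) (Phi : Type) :=
  VariationalFamily {
  filt : Phi -> nat -> X -> R;
  back : Phi -> nat -> X -> X -> R;
  filt_density : forall phi t, (1 <= t)%N -> is_density lam (filt phi t);
  back_density :
    forall phi t, (1 <= t)%N -> is_cond_density lam (back phi t.+1) }.

Section elbo.
Context (R : realType) d (X : measurableType d)
        (lam : {sigma_finite_measure set X -> \bar R})
        dY (Y : measurableType dY) (nu : {measure set Y -> \bar R})
        (Theta Phi : Type).
Variables (M : ssm lam nu Theta) (y : nat -> Y) (Q : variational_family lam Phi).
Variables (th : Theta) (phi : Phi).

(* p_th(x_{1:n+1}, y^{n+1}) *)
Definition joint n (x : n.+1.-tuple X) : R :=
  init M th (at_time x 1) * obs M th (y 1) (at_time x 1) *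
  \prod_(2 <= k < n.+2) (trans M th (at_time x k) (at_time x k.-1) *
                         obs M th (y k) (at_time x k)).

(* q_{n+1}(x_{1:n} | x_{n+1}), with xs = x_{1:n} and x = x_{n+1}             *)
Definition var_cond n (xs : n.-tuple X) (x : X) : R :=
  let z := rcons_pair (xs, x) in
  \prod_(1 <= k < n.+1) back Q phi k.+1 (at_time z k) (at_time z k.+1).

(* q_{n+1}(x_{1:n+1}) *)
Definition var_joint n (x : n.+1.-tuple X) : R :=
  filt Q phi n.+1 (at_time x n.+1) *
  \prod_(1 <= k < n.+1) back Q phi k.+1 (at_time x k) (at_time x k.+1).

(* m_{t+1}(x' | x) *)
Definition fwd_ratio (t : nat) (x' x : X) : R :=
  back Q phi t.+1 x x' * filt Q phi t.+1 x' / filt Q phi t x.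

(* The quotient defining m_{t+1} is never of the form a / 0 with a != 0;     *)
(* equivalently q_{t+1}(x_t | x_{t+1}) q_{t+1}(x_{t+1}) =                    *)
(* q_t(x_t) m_{t+1}(x_{t+1} | x_t).                                          *)
Definition fwd_ratio_defined : Prop :=
  forall t, (1 <= t)%N -> forall x x' : X,
    filt Q phi t x = 0 -> back Q phi t.+1 x x' * filt Q phi t.+1 x' = 0.

(* lne 0 = -oo: the model densities may vanish. Where var_joint x = 0 the    *)
(* quotient is 0 by convention; such x have weight 0 in elbo.                *)
Definition log_ratio n (x : n.+1.-tuple X) : \bar R :=
  lne (joint x / var_joint x)%:E.

(* L_{n+1}(th, phi) *)
Definition elbo n : \bar R :=
  expect (tuple_measure lam n.+1) (@var_joint n) (@log_ratio n).

(* r_{n+1}(x_n, x_{n+1}), with x = x_n and x' = x_{n+1}; r_1 ignores x.      *)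
Definition reward n (x x' : X) : \bar R :=
  match n with
  | 0 => lne (init M th x' * obs M th (y 1) x' / filt Q phi 1 x')%:E
  | t.+1 => lne (trans M th x' x * obs M th (y t.+2) x' /
                 fwd_ratio t.+1 x' x)%:E
  end.

(* V_{n+1}(x_{n+1}); the first argument of reward 0 is a dummy x_0.          *)
Definition value n (x : X) : \bar R :=
  match n with
  | 0 => reward 0 x x
  | t.+1 => expect (tuple_measure lam t.+1) (fun xs => var_cond xs x)
              (fun xs => log_ratio (rcons_pair (xs, x)))
  end.

(* The expectations defining L_{n+1} and V_{n+1}(x_{n+1}) exist.             *)
Definition elbo_exists n : Prop :=
  expect_exists (tuple_measure lam n.+1) (@var_joint n) (@log_ratio n).

Definition value_exists n (x : X) : Prop :=
  expect_exists (tuple_measure lam n) (fun xs => var_cond xs x)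
    (fun xs => log_ratio (rcons_pair (xs, x))).

End elbo.

(* Main.v *)
(* Both identities are Fubini for the factorization of q_t(x_{1:t}) through its
   last coordinate. Existence of the expectation means that the positive or the
   negative part is integrable, so Tonelli on each part and subtraction suffice.
   In the recursion, log (p_{t+1} / q_{t+1}) splits pointwise as
   log (p_t / q_t) + r_{t+1}, and the reward is constant in x_{1:t-1}, so it can
   be taken out of the inner expectation because q_t(x_{1:t-1} | x_t) has mass
   one. *)
Require Import Defs.
From mathcomp Require Import all_boot all_order all_algebra.
From mathcomp Require Import all_classical all_reals all_analysis.
From mathcomp Require Import ring lra measurable_realfun.

Set Implicit Arguments.
Unset Strict Implicit.
Unset Printing Implicit Defensive.
Import Order.TTheory GRing.Theory Num.Theory.
Local Open Scope ring_scope.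

(** * Linearity of the extended integral, with the convention oo - oo = -oo *)

Section integral_without_integrability.
Context d (T : measurableType d) (R : realType).
Variable mu : {measure set T -> \bar R}.
Local Open Scope ereal_scope.
Implicit Types (f g : T -> \bar R) (k : T -> R).

(** With h = f - g, the identity h^+ + g = f + h^- involves only nonnegative functions, so it can be
    integrated term by term. Since h^+ <= f and h^- <= g, the finite integral among those of f and g
    makes the corresponding part of h finite, and the integrated identity can be rearranged. *)
Lemma integralB_ge0 f g :
  measurable_fun setT f -> measurable_fun setT g ->
  (forall x, 0 <= f x) -> (forall x, 0 <= g x) ->
  \int[mu]_x f x < +oo \/ \int[mu]_x g x < +oo ->
  \int[mu]_x (f x - g x) = \int[mu]_x f x - \int[mu]_x g x.
Proof.
move=> mf mg f0 g0 fgoo.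
pose h x := f x - g x.
have mh : measurable_fun setT h by exact: emeasurable_funB.
have mhp : measurable_fun setT h^\+ by exact: measurable_funepos.
have mhn : measurable_fun setT h^\- by exact: measurable_funeneg.
(* Valid even when f x = g x = +oo, where h x = -oo. *)
have hE x : h^\+ x + g x = f x + h^\- x.
  rewrite funeposE funenegE /h.
  have := f0 x; have := g0 x; case: (f x) (g x) => [a| |] [b| |] //= b0 a0;
    rewrite ?(maxye, maxNye, addeNy, addye)//.
  rewrite -?EFinN -?EFin_max -?EFinD; congr EFin.
  by rewrite /Order.max; case: ifP; case: ifP; lra.
have hpf : \int[mu]_x h^\+ x <= \int[mu]_x f x.
  apply: ge0_le_integral => // x _; rewrite funeposE /h ge_max f0 andbT.
  by have := f0 x; have := g0 x; case: (f x) (g x) => [a| |] [b| |] //= b0 a0;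
     rewrite -?EFinB ?lee_fin ?leNye// gerBl.
have hng : \int[mu]_x h^\- x <= \int[mu]_x g x.
  apply: ge0_le_integral => // x _; rewrite funenegE /h ge_max g0 andbT.
  by have := f0 x; have := g0 x; case: (f x) (g x) => [a| |] [b| |] //= b0 a0;
     rewrite -?EFinB -?EFinN ?lee_fin ?leNye ?leey// opprB gerBl.
have hp0 : 0 <= \int[mu]_x h^\+ x by exact: integral_ge0.
have hn0 : 0 <= \int[mu]_x h^\- x by exact: integral_ge0.
have F0 : 0 <= \int[mu]_x f x by exact: integral_ge0.
have G0 : 0 <= \int[mu]_x g x by exact: integral_ge0.
rewrite [LHS]integralE -/h.
have : \int[mu]_x h^\+ x + \int[mu]_x g x = \int[mu]_x f x + \int[mu]_x h^\- x.
  by rewrite -!ge0_integralD//; exact: eq_integral.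
move: hpf hng hp0 hn0 F0 G0 fgoo.
case: (integral _ _ h^\+) (integral _ _ h^\-) (integral _ _ f) (integral _ _ g)
  => [a| |] [b| |] [c| |] [e| |] //= _ _ _ _ _ _ []//= _ [] ?;
  by rewrite -!EFinB; congr EFin; lra.
Qed.

(** A nonnegative scalar commutes with positive and negative parts. If both have infinite integral,
    the two sides are -oo for c > 0 and 0 for c = 0. *)
Lemma integral_scaler (c : R) f : measurable_fun setT f -> (0 <= c)%R ->
  \int[mu]_x (c%:E * f x) = c%:E * \int[mu]_x f x.
Proof.
move=> mf c0; rewrite integralE [in RHS]integralE.
rewrite (ge0_funeposM _ c0) (ge0_funenegM _ c0).
rewrite !ge0_integralZl_EFin//;
  [|exact: measurable_funeneg|exact: measurable_funepos].
move: (integral _ _ f^\+) (integral _ _ f^\-) => a b.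
move: c0; rewrite le_eqVlt => /predU1P[<-|c0]; first by rewrite !mul0e sube0.
case: a b => [a| |] [b| |] /=; rewrite ?gt0_muley ?gt0_muleNy ?lte_fin//.
by rewrite -?EFinM -?EFinB -?EFinM mulrBr.
Qed.

(* No quasi-integrability of f is needed: if f^\+ and f^\- both have infinite
   integral then so do those of f + k, and oo - oo = -oo on both sides. *)
Lemma integralD_integrable f k :
  measurable_fun setT f -> mu.-integrable setT (EFin \o k) ->
  \int[mu]_x (f x + (k x)%:E) = \int[mu]_x f x + \int[mu]_x (k x)%:E.
Proof.
move=> mf ik; pose h x := f x + (k x)%:E.
have mk : measurable_fun setT (EFin \o k) by exact: measurable_int ik.
have mh : measurable_fun setT h by exact: emeasurable_funD.
have mhp : measurable_fun setT h^\+ by exact: measurable_funepos.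
have mhn : measurable_fun setT h^\- by exact: measurable_funeneg.
have mfp : measurable_fun setT f^\+ by exact: measurable_funepos.
have mfn : measurable_fun setT f^\- by exact: measurable_funeneg.
have mkp : measurable_fun setT (EFin \o k)^\+ by exact: measurable_funepos.
have mkn : measurable_fun setT (EFin \o k)^\- by exact: measurable_funeneg.
have hE x : h^\+ x + (f^\- x + (EFin \o k)^\- x) =
            h^\- x + (f^\+ x + (EFin \o k)^\+ x).
  rewrite !funeposE !funenegE /h /=; case: (f x) => [a| |] //=;
    rewrite ?(maxye, maxNye, addeNy, addye, addey)// -?EFin_max ?add0e;
    rewrite ?lee_fin ?le_max ?lexx ?orbT//.
  rewrite -?EFinN -?EFinD -?EFinN -?EFin_max -?EFinD; congr EFin.
  by rewrite /Order.max; do 6?case: ifP; lra.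
(* This bound and the next show that f^- and h^- have infinite integral together. In that case both
   sides are -oo; otherwise the integrated form of [hE] can be rearranged. *)
have fn_le : \int[mu]_x f^\- x <=
    \int[mu]_x h^\- x + \int[mu]_x (EFin \o k)^\+ x.
  rewrite -ge0_integralD//; apply: ge0_le_integral => //.
    exact: emeasurable_funD.
  move=> x _; rewrite !funeposE !funenegE /h /=; case: (f x) => [a| |] //=;
    rewrite ?(maxye, maxNye, addeNy, addye, addey)// -?EFin_max ?add0e;
    rewrite ?lee_fin ?le_max ?lexx ?orbT//.
  rewrite -?EFinN -?EFinD -?EFinN -?EFin_max -?EFinD ?lee_fin.
  by rewrite /Order.max; do 3?case: ifP; lra.
have hn_le : \int[mu]_x h^\- x <=
    \int[mu]_x f^\- x + \int[mu]_x (EFin \o k)^\- x.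
  rewrite -ge0_integralD//; apply: ge0_le_integral => //.
    exact: emeasurable_funD.
  move=> x _; rewrite ?funeposE !funenegE /h /=; case: (f x) => [a| |] //=;
    rewrite ?(maxye, maxNye, addeNy, addye, addey)// -?EFin_max ?add0e;
    rewrite ?lee_fin ?le_max ?lexx ?orbT//.
  rewrite -?EFinN -?EFinD -?EFinN -?EFin_max -?EFinD ?lee_fin.
  by rewrite /Order.max; do 3?case: ifP; lra.
rewrite [LHS]integralE -/h [integral _ _ f]integralE.
rewrite [integral _ _ (fun=> _%:E)]integralE.
have : \int[mu]_x h^\+ x + (\int[mu]_x f^\- x + \int[mu]_x (EFin \o k)^\- x) =
       \int[mu]_x h^\- x + (\int[mu]_x f^\+ x + \int[mu]_x (EFin \o k)^\+ x).
  have mfk : measurable_fun setT (f^\- \+ (EFin \o k)^\-).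
    exact: emeasurable_funD.
  have mfk' : measurable_fun setT (f^\+ \+ (EFin \o k)^\+).
    exact: emeasurable_funD.
  by rewrite -!ge0_integralD//;
    [exact: eq_integral|move=> x _; exact: adde_ge0..].
have kpoo := integral_funepos_lt_pinfty measurableT ik.
have knoo := integral_funeneg_lt_pinfty measurableT ik.
have hp0 : 0 <= \int[mu]_x h^\+ x by exact: integral_ge0.
have hn0 : 0 <= \int[mu]_x h^\- x by exact: integral_ge0.
have fp0 : 0 <= \int[mu]_x f^\+ x by exact: integral_ge0.
have fn0 : 0 <= \int[mu]_x f^\- x by exact: integral_ge0.
have kp0 : 0 <= \int[mu]_x (EFin \o k)^\+ x by exact: integral_ge0.
have kn0 : 0 <= \int[mu]_x (EFin \o k)^\- x by exact: integral_ge0.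
move: fn_le hn_le kpoo knoo hp0 hn0 fp0 fn0 kp0 kn0.
case: (integral _ _ (EFin \o k)^\+) => [p| |] //;
case: (integral _ _ (EFin \o k)^\-) => [q| |] //=.
case: (integral _ _ h^\+) (integral _ _ h^\-)
     (integral _ _ f^\+) (integral _ _ f^\-)
  => [a| |] [b| |] [c| |] [e| |] //=.
by move=> _ _ _ _ _ _ _ _ _ _; rewrite -?EFinD => -[] ?; congr EFin; lra.
Qed.

End integral_without_integrability.

(** * Tonelli and Fubini for the product measure on tuples *)

Section integral_tuple_measure.
Context d (T : measurableType d) (R : realType).
Local Open Scope ereal_scope.
Variable mu : {sigma_finite_measure set T -> \bar R}.

Lemma integral_tuple_measure0 (F : 0.-tuple T -> \bar R) :
  measurable_fun setT F -> \int[tuple_measure mu 0]_w F w = F [tuple].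
Proof. by move=> mF; rewrite integral_dirac// diracT mul1e. Qed.

(** Change of variables along [rcons_pair], then Tonelli in the order that leaves the last
    coordinate outermost: the variational family conditions backwards, on the last state. *)
Lemma ge0_integral_tuple_measureS n (F : n.+1.-tuple T -> \bar R) :
  measurable_fun setT F -> (forall z, 0 <= F z) ->
  \int[tuple_measure mu n.+1]_z F z =
  \int[mu]_x \int[tuple_measure mu n]_w F (rcons_pair (w, x)).
Proof.
move=> mF F0.
rewrite (ge0_integral_pushforward (@measurable_rcons_pair _ T n))//.
rewrite preimage_setT fubini_tonelli2//; last by move=> ?; exact: F0.
by apply: measurableT_comp => //; exact: measurable_rcons_pair.
Qed.

Lemma measurable_integral_tuple_measure n (F : n.+1.-tuple T -> \bar R) :
  measurable_fun setT F -> (forall z, 0 <= F z) ->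
  measurable_fun setT
    (fun x => \int[tuple_measure mu n]_w F (rcons_pair (w, x))).
Proof.
move=> mF F0.
apply: (@measurable_fun_fubini_tonelli_G _ _ _ _ _ (tuple_measure mu n)
  (F \o @rcons_pair _ T n)) => [|?]; last exact: F0.
by apply: measurableT_comp => //; exact: measurable_rcons_pair.
Qed.

Lemma measurable_rcons_pair1 n (x : T) :
  measurable_fun setT (fun w : n.-tuple T => rcons_pair (w, x)).
Proof. exact: (measurable_fun_pair1 x (@measurable_rcons_pair _ T n)). Qed.

Lemma integral_tuple_measureS n (F : n.+1.-tuple T -> \bar R) :
  measurable_fun setT F ->
  \int[tuple_measure mu n.+1]_z F^\+ z < +oo \/
  \int[tuple_measure mu n.+1]_z F^\- z < +oo ->
  \int[tuple_measure mu n.+1]_z F z =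
  \int[mu]_x \int[tuple_measure mu n]_w F (rcons_pair (w, x)).
Proof.
move=> mF.
have mFp : measurable_fun setT F^\+ by exact: measurable_funepos.
have mFn : measurable_fun setT F^\- by exact: measurable_funeneg.
(* The finiteness hypothesis is rewritten too, so [Foo] speaks of the iterated integrals, as
   [integralB_ge0] requires. *)
rewrite [in X in _ -> X]integralE !ge0_integral_tuple_measureS// => Foo.
rewrite -integralB_ge0//; try exact: measurable_integral_tuple_measure.
- apply: eq_integral => x _; rewrite [RHS]integralE; congr (_ - _).
    by apply: eq_integral => w _; rewrite !funeposE.
  by apply: eq_integral => w _; rewrite !funenegE.
- by move=> x; exact: integral_ge0.
- by move=> x; exact: integral_ge0.
Qed.

End integral_tuple_measure.

(** * Logarithms of quotients, expectations under a density, coordinates of a trajectory *)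

Section densities_and_trajectories.
Context d (T : measurableType d) (R : realType).
Local Open Scope ereal_scope.

Lemma measurable_lne_div (f g : T -> R) :
  measurable_fun setT f -> measurable_fun setT g ->
  (forall x, 0 <= f x)%R -> (forall x, 0 <= g x)%R ->
  measurable_fun setT (fun x => lne (f x / g x)%:E).
Proof.
move=> mf mg f0 g0.
(* A zero numerator and a zero denominator both give quotient 0, hence logarithm -oo. *)
rewrite (_ : (fun x => _) = (fun x => if (0 < f x)%R then
    if (0 < g x)%R then (ln (f x) - ln (g x))%:E else -oo else -oo)).
  apply: measurable_fun_ifT => //.
    exact: (measurable_fun_ltr (measurable_cst (0%R : R)) mf).
  apply: measurable_fun_ifT => //.
    exact: (measurable_fun_ltr (measurable_cst (0%R : R)) mg).
  by apply/measurable_EFinP/measurable_funB; exact: measurableT_comp.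
apply/funext => x; have := f0 x; rewrite le_eqVlt => /predU1P[<-|fx].
  by rewrite mul0r ltxx le0_lneNy.
rewrite fx; have := g0 x; rewrite le_eqVlt => /predU1P[<-|gx].
  by rewrite invr0 mulr0 ltxx le0_lneNy.
by rewrite gx lne_EFin ?divr_gt0// ln_div// posrE.
Qed.

Lemma lne_EFinM (a b : R) : (0 <= a)%R -> (0 <= b)%R ->
  lne (a * b)%:E = lne a%:E + lne b%:E.
Proof.
rewrite le_eqVlt => /predU1P[<- _|a0].
  by rewrite mul0r [lne 0%:E]le0_lneNy // addNye.
rewrite le_eqVlt => /predU1P[<-|b0].
  by rewrite mulr0 [lne 0%:E]le0_lneNy// addeNy.
by rewrite !lne_EFin ?mulr_gt0// lnM// posrE.
Qed.

(** Ensures that rewards satisfy the side condition of [expectDr]. *)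
Lemma lne_EFin_neqy (a : R) : lne a%:E != +oo.
Proof. by rewrite /=; case: ifP. Qed.

(* For r = -oo both sides are -oo, whatever h is, because p has mass one. *)
Lemma expectDr (mu : {measure set T -> \bar R}) (p : T -> R) (h : T -> \bar R)
    (r : \bar R) :
  is_density mu p -> measurable_fun setT h -> r != +oo ->
  expect mu p (fun x => h x + r) = expect mu p h + r.
Proof.
move=> [mp p0 p1] mh; rewrite /expect.
have mpE : measurable_fun setT (EFin \o p) by exact/measurable_EFinP.
case: r => [r _| //|_].
  pose k x := (p x * r)%R.
  have ik : mu.-integrable setT (EFin \o k).
    rewrite /k (_ : EFin \o _ = fun x => (p x)%:E * r%:E); last first.
      by apply/funext => x /=; rewrite EFinM.
    apply: integrableZr => //; apply/integrableP; split => //.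
    under eq_integral do rewrite /= ger0_norm//.
    by rewrite p1 ltry.
  under eq_integral do rewrite muleDr// ?fin_num_adde_defl// -EFinM.
  rewrite (integralD_integrable _ ik) /k; last exact: emeasurable_funM.
  congr (_ + _); under eq_integral do rewrite EFinM.
  rewrite integralZr//; last first.
    apply/integrableP; split => //.
    under eq_integral do rewrite /= ger0_norm//.
    by rewrite p1 ltry.
  by rewrite p1 mul1e.
rewrite addeNy.
under eq_integral do rewrite addeNy.
(* The integrand p * -oo is the opposite of a nonnegative function of integral 1 * +oo; it is 0
   where p vanishes. *)
transitivity (\int[mu]_x - ((p x)%:E * +oo)).
  by apply: eq_integral => x _; rewrite -muleN.
rewrite integral_ge0N; last by move=> x _; rewrite mule_ge0// lee_fin.
rewrite ge0_integralZr//; last by move=> x _; rewrite lee_fin.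
by rewrite p1 mul1e.
Qed.

Lemma measurable_cond d' (U : measurableType d') d1 (S : measurableType d1)
    (k : T -> U -> R) (a : S -> T) (b : S -> U) :
  measurable_fun setT (fun xu : T * U => k xu.1 xu.2) ->
  measurable_fun setT a -> measurable_fun setT b ->
  measurable_fun setT (fun s => k (a s) (b s)).
Proof.
move=> mk ma mb.
exact: (measurableT_comp mk (measurable_fun_pair ma mb)).
Qed.

Lemma measurable_at_time n k :
  measurable_fun setT (fun z : n.+1.-tuple T => at_time z k).
Proof.
have [kn|nk] := ltnP k.-1 n.+1.
  rewrite (_ : (fun z => _) = (fun z : n.+1.-tuple T => tnth z (Ordinal kn))).
    exact: measurable_tnth.
  by apply/funext => z; rewrite (tnth_nth (thead z)).
(* Out of range, [at_time] returns its default [thead z], which is coordinate 0. *)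
rewrite (_ : (fun z => _) = (fun z : n.+1.-tuple T => tnth z ord0)).
  exact: measurable_tnth.
by apply/funext => z; rewrite /at_time nth_default// size_tuple.
Qed.

Lemma at_time_rcons n (z : n.+1.-tuple T) (x : T) k :
  (k <= n.+1)%N -> at_time (rcons_pair (z, x)) k = at_time z k.
Proof.
(* Time 0 is covered as well, because 0.-1 = 0. The two defaults differ syntactically but are never
   reached. *)
move=> kn; have {}kn : (k.-1 < n.+1)%N by case: k kn.
rewrite /at_time /= nth_rcons size_tuple kn.
by apply: set_nth_default; rewrite size_tuple.
Qed.

Lemma at_time_last n (w : n.-tuple T) (x : T) :
  at_time (rcons_pair (w, x)) n.+1 = x.
Proof. by rewrite /at_time /= nth_rcons size_tuple ltnn eqxx. Qed.

End densities_and_trajectories.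

(** * Effect of appending a state on the trajectory densities *)

Section elbo_recursion.
Context (R : realType) d (X : measurableType d)
        (lam : {sigma_finite_measure set X -> \bar R})
        dY (Y : measurableType dY) (nu : {measure set Y -> \bar R})
        (Theta Phi : Type).
Local Open Scope ereal_scope.
Variables (M : ssm lam nu Theta) (y : nat -> Y)
  (Q : variational_family lam Phi).
Variables (th : Theta) (phi : Phi).

Local Notation joint := (joint M y th).
Local Notation var_cond := (var_cond Q phi).
Local Notation var_joint := (var_joint Q phi).
Local Notation log_ratio := (log_ratio M y Q th phi).
Local Notation reward := (reward M y Q th phi).
Local Notation value := (value M y Q th phi).

Lemma var_joint_rcons n (w : n.-tuple X) (x : X) :
  var_joint (rcons_pair (w, x)) = (filt Q phi n.+1 x * var_cond w x)%R.
Proof. by rewrite /Defs.var_joint at_time_last. Qed.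

Lemma var_cond_rcons n (w : n.-tuple X) (x x' : X) :
  var_cond (rcons_pair (w, x)) x' = (var_cond w x * back Q phi n.+2 x x')%R.
Proof.
rewrite /Defs.var_cond big_nat_recr// !at_time_last at_time_rcons//.
rewrite at_time_last; congr (_ * _)%R; apply: eq_big_nat => k /andP[_ kn].
by rewrite !at_time_rcons// ltnW.
Qed.

Lemma joint_rcons n (z : n.+1.-tuple X) (x : X) :
  joint (rcons_pair (z, x)) =
  (joint z * (trans M th x (at_time z n.+1) * obs M th (y n.+2) x))%R.
Proof.
rewrite /Defs.joint big_nat_recr// [n.+2.-1]/= !at_time_last.
rewrite !at_time_rcons// -[RHS]mulrA.
congr (_ * (_ * _))%R; apply: eq_big_nat => k /andP[_ kn].
by rewrite !at_time_rcons// (leq_trans (leq_pred _)).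
Qed.

(** * Signs and measurability of the densities *)

Lemma filt_ge0 n x : (0 <= filt Q phi n.+1 x)%R.
Proof. by have [] := filt_density Q phi (ltn0Sn n). Qed.

Lemma back_ge0 n x x' : (0 <= back Q phi n.+2 x x')%R.
Proof. by have [_ /(_ x')[]] := back_density Q phi (ltn0Sn n). Qed.

Lemma trans_ge0 x x' : (0 <= trans M th x x')%R.
Proof. by have [_ /(_ x')[]] := trans_density M th. Qed.

Lemma obs_ge0 v x : (0 <= obs M th v x)%R.
Proof. by have [_ /(_ x)[]] := obs_density M th. Qed.

Lemma var_cond_ge0 n (w : n.-tuple X) x : (0 <= var_cond w x)%R.
Proof.
(* [big_nat] retains the bound 1 <= k: [back] is known to be a density only from index 2 on. *)
rewrite /Defs.var_cond big_nat; apply: prodr_ge0 => -[//|k] _; exact: back_ge0.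
Qed.

Lemma var_joint_ge0 n (z : n.+1.-tuple X) : (0 <= var_joint z)%R.
Proof.
rewrite mulr_ge0 ?filt_ge0// big_nat.
by apply: prodr_ge0 => -[//|k] _; exact: back_ge0.
Qed.

Lemma joint_ge0 n (z : n.+1.-tuple X) : (0 <= joint z)%R.
Proof.
have [_ init0 _] := init_density M th.
rewrite !mulr_ge0 ?obs_ge0//; apply: prodr_ge0 => k _.
by rewrite mulr_ge0 ?trans_ge0 ?obs_ge0.
Qed.

Lemma measurable_back_at n m k l :
  (0 < k)%N -> measurable_fun setT
    (fun z : n.+1.-tuple X => back Q phi k.+1 (at_time z l) (at_time z m)).
Proof.
move=> k0; have [mb _] := back_density Q phi k0.
by apply: measurable_cond => //; exact: measurable_at_time.
Qed.

Lemma measurable_obs v : measurable_fun setT (obs M th v).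
Proof.
have [mo _] := obs_density M th.
exact: (measurable_cond mo (measurable_cst v) (@measurable_id _ _ setT)).
Qed.

Lemma measurable_var_joint n :
  measurable_fun setT (@Defs.var_joint _ _ _ _ _ Q phi n).
Proof.
apply: measurable_funM.
  have [mf _ _] := filt_density Q phi (ltn0Sn n).
  exact: (measurableT_comp mf (@measurable_at_time _ _ _ _)).
apply: measurable_prod => k; rewrite mem_index_iota => /andP[k0 _].
exact: measurable_back_at.
Qed.

Lemma measurable_var_cond n (x : X) :
  measurable_fun setT (fun w : n.-tuple X => var_cond w x).
Proof.
apply: measurable_prod => k; rewrite mem_index_iota => /andP[k0 _].
exact: (measurableT_comp (measurable_back_at _ _ k0)
  (measurable_rcons_pair1 _)).
Qed.

Lemma measurable_EFin_var_joint n :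
  measurable_fun setT (fun z : n.+1.-tuple X => (var_joint z)%:E).
Proof. by apply/measurable_EFinP; exact: measurable_var_joint. Qed.

Lemma measurable_EFin_var_cond n (x : X) :
  measurable_fun setT (fun w : n.-tuple X => (var_cond w x)%:E).
Proof. by apply/measurable_EFinP; exact: measurable_var_cond. Qed.

Lemma measurable_joint n :
  measurable_fun setT (@Defs.joint _ _ _ _ _ _ _ _ M y th n).
Proof.
have [mi _ _] := init_density M th.
have mat k : measurable_fun setT (fun z : n.+1.-tuple X => at_time z k).
  exact: measurable_at_time.
have mobs k v : measurable_fun setT
    (fun z : n.+1.-tuple X => obs M th v (at_time z k)).
  by apply: measurableT_comp => //; exact: measurable_obs.
apply: measurable_funM.
  by apply: measurable_funM => //; exact: measurableT_comp.
apply: measurable_prod => k _; apply: measurable_funM => //.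
by have [mt _] := trans_density M th; exact: measurable_cond.
Qed.

Lemma measurable_log_ratio n :
  measurable_fun setT (@Defs.log_ratio _ _ _ _ _ _ _ _ _ M y Q th phi n).
Proof.
apply: measurable_lne_div;
  [exact: measurable_joint|exact: measurable_var_joint|..].
  exact: joint_ge0.
exact: var_joint_ge0.
Qed.

Lemma measurable_log_ratio_rcons n (x : X) :
  measurable_fun setT (fun w : n.-tuple X => log_ratio (rcons_pair (w, x))).
Proof.
exact: (measurableT_comp (@measurable_log_ratio n) (measurable_rcons_pair1 _)).
Qed.

(** Induction on the length: given the last coordinate, the earlier states integrate to one by
    induction, and what remains is the mass of one backward kernel. *)
Lemma is_density_var_cond n (x : X) :
  is_density (tuple_measure lam n) (fun w => var_cond w x).
Proof.
split; [exact: measurable_var_cond|by move=> w; exact: var_cond_ge0|].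
elim: n x => [|n IHn] x'.
  rewrite integral_tuple_measure0; last exact: measurable_EFin_var_cond.
  by rewrite /Defs.var_cond big_geq.
rewrite ge0_integral_tuple_measureS; first last.
- by move=> w; rewrite lee_fin var_cond_ge0.
- exact: measurable_EFin_var_cond.
have [_ /(_ x')[_ _ <-]] := back_density Q phi (ltn0Sn n).
apply: eq_integral => x _.
under eq_integral do rewrite var_cond_rcons mulrC EFinM.
rewrite integral_scaler ?back_ge0 ?IHn ?mule1//.
exact: measurable_EFin_var_cond.
Qed.

(** Makes the initial convention an instance of the general formula: the product measure on empty
    tuples is a Dirac mass and all the products are empty. *)
Lemma valueE n (x : X) :
  value n x = expect (tuple_measure lam n) (fun w => var_cond w x)
                (fun w => log_ratio (rcons_pair (w, x))).
Proof.
case: n => [|//]; rewrite /expect integral_tuple_measure0.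
  rewrite /Defs.var_cond /Defs.log_ratio /Defs.joint /Defs.var_joint !big_geq//.
  by rewrite mul1e !mulr1.
apply: emeasurable_funM; last exact: measurable_log_ratio_rcons.
exact: measurable_EFin_var_cond.
Qed.

(* Where q_{n+1}(x) = 0, both sides are -oo: the hypothesis forces the weight
   q_{n+2}(x | x') q_{n+2}(x') to vanish, and dividing by 0 gives 0. *)
Lemma log_ratio_rcons n (w : n.-tuple X) (x x' : X) :
  fwd_ratio_defined Q phi ->
  log_ratio (rcons_pair (rcons_pair (w, x), x')) =
  log_ratio (rcons_pair (w, x)) + reward n.+1 x x'.
Proof.
move=> fwdQ; rewrite /= -lne_EFinM; first last.
- by rewrite !(divr_ge0, mulr_ge0) ?trans_ge0 ?obs_ge0 ?back_ge0 ?filt_ge0.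
- by rewrite divr_ge0 ?joint_ge0 ?var_joint_ge0.
rewrite /Defs.log_ratio !var_joint_rcons var_cond_rcons.
rewrite joint_rcons at_time_last.
congr (lne _%:E); rewrite /fwd_ratio.
(* Only q_{n+1}(x) gets cancelled; the other denominators may vanish, since inversion is total and
   multiplicative. *)
have [f0|f0] := eqVneq (filt Q phi n.+1 x) 0%R; last first.
  rewrite !invfM invrK.
  transitivity (joint (rcons_pair (w, x)) / var_cond w x *
    (trans M th x' x * obs M th (y n.+2) x' / back Q phi n.+2 x x' /
     filt Q phi n.+2 x') * (filt Q phi n.+1 x / filt Q phi n.+1 x))%R.
    by rewrite divff//; ring.
  by ring.
have bf0 := fwdQ n.+1 isT x x' f0.
rewrite f0 mul0r invr0 !mulr0 mul0r.
rewrite [X in (_ / X)%R](_ : _ = 0)%R ?invr0 ?mulr0//.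
by rewrite mulrCA [(filt _ _ _ _ * _)%R]mulrC bf0 mulr0.
Qed.

(** * The two identities *)

Lemma elboE n : elbo_exists M y Q th phi n ->
  elbo M y Q th phi n = expect lam (filt Q phi n.+1) (value n).
Proof.
move=> ex; rewrite /elbo /expect integral_tuple_measureS//; last first.
  apply: emeasurable_funM; last exact: measurable_log_ratio.
  exact: measurable_EFin_var_joint.
(* At an individual x the inner expectation may be oo - oo; [integral_scaler] covers this case. *)
apply: eq_integral => x _; rewrite valueE -integral_scaler ?filt_ge0//.
  by apply: eq_integral => w _; rewrite var_joint_rcons EFinM muleA.
apply: emeasurable_funM; last exact: measurable_log_ratio_rcons.
exact: measurable_EFin_var_cond.
Qed.

Lemma value_recursion n (x' : X) : fwd_ratio_defined Q phi ->
  value_exists M y Q th phi n.+1 x' ->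
  value n.+1 x' = expect lam (fun x => back Q phi n.+2 x x')
    (fun x => value n x + reward n.+1 x x').
Proof.
move=> fwdQ ex; rewrite [LHS]/expect integral_tuple_measureS//; last first.
  apply: emeasurable_funM; last exact: measurable_log_ratio_rcons.
  exact: measurable_EFin_var_cond.
(* The reward moves under the inner expectation, where it completes the log ratio at time n+1 to the
   one at time n+2. The backward kernel then moves inside and completes [var_cond]. *)
apply: eq_integral => x _; rewrite valueE -expectDr; first last.
- exact: lne_EFin_neqy.
- exact: measurable_log_ratio_rcons.
- exact: is_density_var_cond.
rewrite -integral_scaler ?back_ge0//.
  apply: eq_integral => w _; rewrite log_ratio_rcons// var_cond_rcons.
  by rewrite muleA -EFinM mulrC.
apply: emeasurable_funM; first exact: measurable_EFin_var_cond.
apply: emeasurable_funD => //; exact: measurable_log_ratio_rcons.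
Qed.

End elbo_recursion.

Theorem proposition1 (R : realType) (dx dth : nat)
    (dY : measure_display) (Y : measurableType dY)
    (nu : {measure set Y -> \bar R})
    (M : ssm (lebesgue R dx) nu (euclidean R dth))
    (y : nat -> Y)
    (Phi : Type) (Q : variational_family (lebesgue R dx) Phi)
    (th : euclidean R dth) (phi : Phi) :
  (forall n : nat, elbo_exists M y Q th phi n ->
     elbo M y Q th phi n =
     expect (lebesgue R dx) (filt Q phi n.+1) (value M y Q th phi n)) /\
  (fwd_ratio_defined Q phi ->
   forall (n : nat) (x' : euclidean R dx),
     value_exists M y Q th phi n.+1 x' ->
     value M y Q th phi n.+1 x' =
     expect (lebesgue R dx) (fun x => back Q phi n.+2 x x')
       (fun x => (value M y Q th phi n x + reward M y Q th phi n.+1 x x')%E)).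
Proof.
split=> [n|fwdQ n x']; first exact: elboE.
exact: value_recursion.
Qed.
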